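(* Let $p\ge 1$ be an integer and let $G$ be a connected graph whose edges are colored with colors $1$ and $2$ such that there is at least one edge of each color. For $i\in\{1,2\}$, let $G_i$ denote the subgraph of $G$ (with vertex set $V(G)$) consisting of the edges of color $i$. If the average degree of $G_1$ satisfies $d(G_1)\ge p+1$, then there exists a path of length at least $p$ in $G$ such that its first edge has color $2$ and all its other edges have color $1$.
   Context: Graphs are finite and simple. The length of a path is its number of edges. $d(\cdot)$ denotes average degree, so $d(G_1)=2e(G_1)/|V(G)|$. The edge-coloring is arbitrary (not necessarily proper). *)

(* Defs.v *)
From mathcomp Require Import all_boot all_order all_algebra.

Set Implicit Arguments.
Unset Strict Implicit.
Unset Printing Implicit Defensive.

Import GRing.Theory.
Local Open Scope ring_scope.

(* A finite simple graph on V is given by its adjacency relation. *)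
Definition simple_graph (V : finType) (e : rel V) : Prop :=
  symmetric e /\ irreflexive e.

Definition connected_graph (V : finType) (e : rel V) : Prop :=
  (0 < #|V|)%N /\ forall x y : V, connect e x y.

Definition edges (V : finType) (e : rel V) : {set {set V}} :=
  [set [set x; y] | x in V, y in V & e x y].

Definition avg_degree (V : finType) (e : rel V) : rat :=
  2%:R * #|edges e|%:R / #|V|%:R.

(* A colouring is defined on all vertex sets, but only its values on edges
   matter. *)
Definition edge_2coloring (V : finType) (e : rel V) (c : {set V} -> nat) : Prop :=
  forall f : {set V}, f \in edges e -> c f = 1%N \/ c f = 2%N.

Definition color_subgraph (V : finType) (e : rel V) (c : {set V} -> nat)
    (i : nat) : rel V :=
  [rel x y | e x y && (c [set x; y] == i)].

(* The path visits x and then the vertices of s in order, all distinct, so its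
   length (number of edges) is size s. *)
Definition graph_path (V : finType) (e : rel V) (x : V) (s : seq V) : bool :=
  path e x s && uniq (x :: s).

(* Main.v *)
Require Import Defs.
From mathcomp Require Import all_boot all_order all_algebra.
From mathcomp Require Import zify.

Set Implicit Arguments.
Unset Strict Implicit.
Unset Printing Implicit Defensive.

Import GRing.Theory Num.Theory.
Local Open Scope ring_scope.

(** Let g be the graph of edges of color 1.  Pick an edge xy of color 2 and
    delete x from g: at most 2(n - 1) is lost from the degree sum (p + 1)n,
    so what is left exceeds (p - 1)(n - 2), and by the Erdos-Gallai circumference
    theorem (degree_sum_le_circumference) g - x has a cycle K with at least p
    vertices.

    If x or y is joined to K in g, take a g-path from one of them that
    leads to K and avoids the other: if y lies on K, the path at y without edges
    will do, and otherwise a path from one endpoint through the other can be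
    cut at the other.  Going around K from the point where K is first met
    gives a g-path with at least p - 1 edges from one endpoint avoiding the
    other, which does not lie on K either; prepend the edge xy
    (edge_then_path_to_cycle).

    If neither x nor y is joined to K in g, the g-component of K is not the
    whole vertex set, so by connectivity some edge leaves it.  That edge
    has color 2, its outer end lies off K and its inner end is joined to K, so
    it can take the place of xy in the same argument.

    Cycles are duplicate-free cyclic sequences, so an edge traversed back and
    forth counts as a cycle with two vertices and the small values of p need
    no separate treatment. *)

(** * Degree sums *)

Definition nbrs (V : finType) (g : rel V) (A : {set V}) (u : V) : {set V} :=
  [set v in A | g u v].

Definition degree_sum (V : finType) (g : rel V) (A : {set V}) : nat :=
  (\sum_(u in A) #|nbrs g A u|)%N.

(** Ordered adjacent pairs with an end in T are split by their first
    vertex; those that enter T from outside are, by symmetry, as many as those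
    that leave it. *)
Lemma degree_sum_setD (V : finType) (g : rel V) (A T : {set V}) :
  symmetric g -> T \subset A ->
  degree_sum g A = (degree_sum g (A :\: T)
    + \sum_(t in T) (#|nbrs g A t| + #|nbrs g (A :\: T) t|))%N.
Proof.
move=> gsym sTA; rewrite /degree_sum.
rewrite (big_setID T) /= (setIidPr sTA) big_split /= addnCA; congr (_ + _)%N.
have -> : (\sum_(t in T) #|nbrs g (A :\: T) t| =
           \sum_(u in A :\: T) #|nbrs g T u|)%N.
  under eq_bigr do rewrite -sum1dep_card big_mkcondr.
  under [RHS]eq_bigr do rewrite -sum1dep_card big_mkcondr.
  rewrite exchange_big /=.
  by apply: eq_bigr => u _; apply: eq_bigr => t _; rewrite gsym.
rewrite -big_split /=; apply: eq_bigr => u _.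
rewrite -(cardsID T (nbrs g A u)) addnC; congr (_ + _)%N; apply: eq_card => v.
  by rewrite !inE andbA.
by rewrite !inE andbC; case: (boolP (v \in T)) => //= /(subsetP sTA) ->.
Qed.

(** Each edge is the image of at least two ordered adjacent pairs. *)
Lemma edges_double_le_degree_sum (V : finType) (g : rel V) :
  symmetric g -> irreflexive g ->
  (2 * #|edges g| <= degree_sum g setT)%N.
Proof.
move=> gsym girr.
pose D := [set uv : V * V | g uv.1 uv.2].
have -> : degree_sum g setT = #|D|.
  rewrite -sum1dep_card /degree_sum (eq_bigl xpredT); last by move=> u; rewrite inE.
  rewrite -(pair_big_dep xpredT (fun u v => g u v) (fun _ _ => 1%N)) /=.
  apply: eq_bigr => u _; rewrite -sum1dep_card; apply: eq_bigl => v.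
  by rewrite in_setT.
pose F (uv : V * V) := [set uv.1; uv.2].
have FD f : f \in edges g -> (2 <= #|[set uv in D | F uv == f]|)%N.
  case/imset2P => u v _; rewrite inE => /andP[_ guv] ->.
  have uv : (u, v) != (v, u).
    by apply: contraL guv => /eqP[-> _]; rewrite girr.
  rewrite -[leqLHS](_ : #|[set (u, v); (v, u)]| = 2%N); last by rewrite cards2 uv.
  apply: subset_leq_card; apply/subsetP => w; rewrite !inE.
  case/orP => /eqP -> /=; rewrite /F /= ?eqxx ?andbT // gsym guv.
  by rewrite setUC eqxx.
rewrite mulnC -sum_nat_const (leq_trans (leq_sum _ FD)) //.
rewrite -[#|D|]sum1_card.
under eq_bigr do rewrite -sum1dep_card.
rewrite (exchange_big_dep (mem D)) /=; last by move=> f uv _ /andP[].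
apply: leq_sum => uv uvD.
rewrite sum1dep_card -(cards1 (F uv)); apply: subset_leq_card.
by apply/subsetP => f; rewrite !inE => /andP[_ /andP[_ /eqP ->]].
Qed.

(** * Cycles from many edges *)

(** Posa rotation.  Paths are listed from the end that moves: the segment
    before v is reversed, the edge uv reconnects it, and the predecessor
    of v becomes the new end. *)
Lemma path_rotation (V : eqType) (g : rel V) (u v : V) (q1 q2 : seq V) :
  symmetric g -> path g u (q1 ++ v :: q2) -> g u v ->
  path g (last u q1) (behead (rev (u :: q1)) ++ v :: q2).
Proof.
move=> gsym; rewrite cat_path /= => /and3P[p1 _ p2] guv.
have E : rev (u :: q1) = last u q1 :: rev (belast u q1).
  by rewrite lastI rev_rcons.
rewrite E /= cat_path /= p2 andbT.
rewrite rev_path (eq_path (e' := g)) ?p1; last by move=> a b; rewrite /= gsym.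
suff -> : last (last u q1) (rev (belast u q1)) = u by [].
by case: (q1) => [|w q] //=; rewrite rev_cons last_rcons.
Qed.

(** The Erdos-Gallai bound on graphs whose cycles have at most k vertices, in
    the form that passes to vertex subsets.  Let P be a longest path, listed
    from an end u whose degree d is maximal among the ends of longest paths.
    A neighbor of the end of a longest path lies among its first k vertices,
    as it closes a cycle.  The predecessors on P of the neighbors of u form a
    set T of d vertices, each the end of a rotated longest path; rotations
    only permute the first k vertices W of P, so T and all neighbors of T lie
    in W.  A vertex of T has at most d neighbors, of which at most k - d lie
    outside T, so deleting T loses at most d(d + (k - d)) = dk from the degree
    sum, and induction applies to the remaining vertices. *)
Lemma degree_sum_le_circumference (V : finType) (g : rel V) (k : nat)
    (A : {set V}) :
  symmetric g -> irreflexive g ->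
  (forall s, cycle g s -> uniq s -> {subset s <= A} -> (size s <= k)%N) ->
  (degree_sum g A <= k * #|A|.-1)%N.
Proof.
move=> gsym girr.
have [n] := ubnP #|A|; elim: n A => // n IH A ltAn hk.
have [/eqP -> //|] := boolP (degree_sum g A == 0)%N.
rewrite sum_nat_eq0 negb_forall_in => /exists_inP[x0 x0A].
rewrite cards_eq0 => /set0Pn[y0]; rewrite inE => /andP[y0A gxy0].
pose isp (P : seq V) := [&& sorted g P, uniq P & all (mem A) P].
(* Lexicographic order on (size, degree of the head), coded in base #|V| + 1. *)
pose mu (P : seq V) := (size P * #|V|.+1 + #|nbrs g A (head x0 P)|)%N.
have szP P : isp P -> (size P <= #|V|)%N.
  by case/and3P=> _ uP _; rewrite -(card_uniqP uP) max_card.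
have [P ispP maxP] : exists2 P, isp P & forall Q, isp Q -> (mu Q <= mu P)%N.
  have isp0 : isp [:: x0] by rewrite /isp /= x0A.
  case: (@arg_maxnP _ (Bseq (szP _ isp0)) (fun P : #|V|.-bseq V => isp P)
           (fun P : #|V|.-bseq V => mu P) isp0) => P ispP maxP.
  by exists P => // Q iQ; exact: (maxP (Bseq (szP _ iQ))).
have nbV u : (#|nbrs g A u| < #|V|.+1)%N by rewrite ltnS max_card.
have maxsz Q : isp Q -> (size Q <= size P)%N.
  move=> /maxP; rewrite /mu => le; rewrite -ltnS.
  have := leq_ltn_trans le (_ : _ < (size P).+1 * #|V|.+1)%N.
  rewrite mulSn addnC ltn_add2r => /(_ (nbV _)) lt.
  by rewrite -(ltn_pmul2r (ltn0Sn #|V|)); apply: leq_ltn_trans lt; rewrite leq_addr.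
have maxdeg Q : isp Q -> size Q = size P ->
    (#|nbrs g A (head x0 Q)| <= #|nbrs g A (head x0 P)|)%N.
  by move=> /maxP; rewrite /mu => + E; rewrite E leq_add2l.
have window u q : isp (u :: q) -> size (u :: q) = size P ->
    {subset nbrs g A u <= take k (u :: q)}.
  move=> iQ sQ v; rewrite inE => /andP[vA guv].
  have /and3P[pq uq Aq] := iQ.
  have vq : v \in u :: q.
    apply: contraT => vNq; have := maxsz (v :: u :: q).
    rewrite -sQ ltnn => -> //; rewrite /isp /= gsym guv -/(uniq (u :: q)).
    by rewrite vNq vA; exact: iQ.
  have iv := vq; rewrite -index_mem in iv.
  rewrite in_take //.
  set i := index v (u :: q) in iv *.
  suff: (size (take i.+1 (u :: q)) <= k)%N by rewrite size_takel.
  apply: hk.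
  - rewrite /= rcons_path take_path //= (last_nth u) size_takel //.
    rewrite -[nth u _ _]/(nth u (take i.+1 (u :: q)) i) nth_take // nth_index //.
    by rewrite gsym.
  - exact: take_uniq.
  - by move=> z /mem_take zq; exact: (allP Aq).
case: P => [|u q] in ispP maxP maxsz maxdeg window *.
  by have := maxsz [:: x0]; rewrite /isp /= x0A; move/(_ isT).
have /and3P[pq uq Aq] := ispP.
have uA : u \in A by case/andP: Aq.
pose d := #|nbrs g A u|.
have winu := window u q ispP erefl.
have nbq v : v \in nbrs g A u -> v \in q.
  move=> vN; have := mem_take (winu _ vN); rewrite inE => /orP[/eqP Ev|//].
  by move: vN; rewrite Ev inE girr andbF.
(* There is an edge x0 y0, so P has at least two vertices. *)
have d_gt0 : (0 < d)%N.
  have := maxsz [:: x0; y0]; rewrite /isp /= gxy0 x0A y0A inE andbT.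
  have -> : x0 != y0 by apply: contraL gxy0 => /eqP ->; rewrite girr.
  move/(_ isT); case: (q) pq Aq => [|w q'] //= /andP[guw _] /and3P[_ wA _] _.
  by apply/card_gt0P; exists w; rewrite inE guw andbT.
(* The indices in u :: q are those in q shifted by one, so f v precedes v. *)
pose f v := nth u (u :: q) (index v q).
pose T := f @: nbrs g A u.
pose W := [set z in take k (u :: q)].
have cardT : #|T| = d.
  apply: card_in_imset => v w /nbq vq /nbq wq /eqP; rewrite /f.
  rewrite nth_uniq ?inE //= ?ltnS ?index_size // => /eqP E.
  by rewrite -(nth_index u vq) E nth_index.
have rot_facts t : t \in T ->
    [/\ t \in W, t \in A, (#|nbrs g A t| <= d)%N & nbrs g A t \subset W].
  case/imsetP=> v vN ->.
  have vq := nbq v vN; have vk := winu v vN.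
  have guv : g u v by move: vN; rewrite inE => /andP[].
  have Ef : f v = last u (take (index v q) q).
    have ivq := vq; rewrite -index_mem in ivq.
    rewrite (last_nth u) size_takel ?index_size // /f.
    by case: (index v q) ivq => // i ivq /=; rewrite nth_take.
  have Eq : q = take (index v q) q ++ v :: drop (index v q).+1 q.
    rewrite -[LHS](cat_take_drop (index v q)) (drop_nth u) ?index_mem //.
    by rewrite nth_index.
  rewrite Ef; set q1 := take _ _ in Eq *; set q2 := drop _ _ in Eq *.
  have vNq1 : v \notin u :: q1.
    move: uq; rewrite Eq -cat_cons cat_uniq => /and3P[_ /hasPn h _].
    by apply: h; rewrite mem_head.
  have szk : (size (u :: q1) < k)%N.
    have iv : index v (u :: q) = size (u :: q1).
      by rewrite Eq -cat_cons index_cat (negPf vNq1) /= eqxx addn0.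
    by rewrite -iv -in_take // inE vq orbT.
  pose Q := rev (u :: q1) ++ v :: q2.
  have EQ : Q = last u q1 :: (behead (rev (u :: q1)) ++ v :: q2).
    by rewrite /Q lastI rev_rcons.
  have permQ : perm_eq Q (u :: q).
    by rewrite Eq -cat_cons perm_cat2r perm_rev.
  have iQ : isp Q.
    rewrite /isp (perm_uniq permQ) uq (perm_all _ permQ) Aq !andbT EQ /=.
    by apply: path_rotation => //; rewrite -Eq.
  have sQ : size Q = size (u :: q) by exact: perm_size.
  have takeQ z : z \in take k Q -> z \in W.
    rewrite inE Eq -cat_cons !take_cat size_rev ltnNge (ltnW szk) /=.
    by rewrite mem_cat mem_rev -mem_cat.
  rewrite EQ in iQ sQ takeQ.
  split.
  - by apply: takeQ; case: (k) szk => // k' _; rewrite /= mem_head.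
  - by have /and3P[_ _ /= /andP[]] := iQ.
  - exact: (maxdeg _ iQ sQ).
  - by apply/subsetP => z /(window _ _ iQ sQ) /takeQ.
have sTA : T \subset A by apply/subsetP => t /rot_facts[].
have sTW : T \subset W by apply/subsetP => t /rot_facts[].
have cardW : (#|W| <= k)%N.
  by rewrite cardsE (leq_trans (card_size _)) // size_take_min geq_minl.
have dk : (d <= k)%N by rewrite -cardT (leq_trans (subset_leq_card sTW)).
(* A :\: T is nonempty, so that the predecessor in the bound for it is not
   truncated. *)
have dA : (d < #|A|)%N.
  rewrite (cardsD1 u A) uA ltnS; apply: subset_leq_card; apply/subsetP => v.
  rewrite !inE => /andP[-> guv]; rewrite andbT; apply: contraL guv => /eqP ->.
  by rewrite girr.
have cardB : #|A :\: T| = (#|A| - d)%N by rewrite cardsD (setIidPr sTA) cardT.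
have IHB : (degree_sum g (A :\: T) <= k * #|A :\: T|.-1)%N.
  apply: IH; first by rewrite cardB; lia.
  by move=> s cs us sub; apply: hk => // z /sub; rewrite inE => /andP[].
have rmT : (\sum_(t in T) (#|nbrs g A t| + #|nbrs g (A :\: T) t|) <= d * k)%N.
  rewrite -cardT -sum_nat_const; apply: leq_sum => t /rot_facts[_ _ dt sW].
  rewrite -(subnKC dk) leq_add //.
  have : nbrs g (A :\: T) t \subset W :\: T.
    apply/subsetP => z; rewrite inE in_setD => /andP[/andP[zT zA] gz].
    by rewrite in_setD zT; apply: (subsetP sW); rewrite inE zA.
  move/subset_leq_card/leq_trans; apply.
  by rewrite cardsD (setIidPr sTW) cardT leq_sub2r.
rewrite (degree_sum_setD gsym sTA) (leq_trans (leq_add IHB rmT)) //.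
by rewrite cardB [(d * k)%N]mulnC -mulnDr leq_mul2l; apply/orP; right; lia.
Qed.

(** * Paths that run into a cycle *)

(** Follow the path until it first meets K, then go around K.  The bound on the
    support allows a vertex off both q and K to be prepended. *)
Lemma connect_to_long_path (V : finType) (g : rel V) (a : V) (q K : seq V) :
  path g a q -> uniq (a :: q) -> cycle g K -> uniq K -> last a q \in K ->
  exists t, [/\ path g a t, uniq (a :: t), (size K <= (size t).+1)%N
              & {subset a :: t <= (a :: q) ++ K}].
Proof.
move=> pq uq cK uK.
have around b : b \in K -> exists t, [/\ path g b t, uniq (b :: t),
    (size K <= (size t).+1)%N & b :: t =i K].
  move=> bK; have [i s E] := rot_to bK.
  exists s; split; last by move=> z; rewrite -E mem_rot.
  - by move: cK; rewrite -(rot_cycle i) E /= rcons_path => /andP[].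
  - by rewrite -E rot_uniq.
  - by rewrite -(size_rot i K) E.
elim: q a pq uq => [|w q IH] a.
  move=> _ _ /around[t [pt ut st tK]]; exists t; split=> // z.
  by rewrite mem_cat tK orbC => ->.
case/andP=> gaw pq /andP[aNq uq] lK.
have [/around[t [pt ut st tK]]|aNK] := boolP (a \in K).
  by exists t; split=> // z; rewrite mem_cat tK orbC => ->.
have [t [pt ut st sub]] := IH w pq uq lK.
exists (w :: t); split.
- by rewrite /= gaw.
- rewrite cons_uniq ut andbT; apply/negP => /sub.
  by rewrite mem_cat (negPf aNq) (negPf aNK).
- exact: leq_trans st _.
- move=> z; rewrite in_cons => /orP[/eqP ->|/sub zin]; first exact: mem_head.
  by rewrite cat_cons in_cons zin orbT.
Qed.

(** The edge xy is oriented so that the path to K starts at its head a and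
    misses its tail b: a = y if y lies on K, and otherwise a is the last of x
    and y on some path to K. *)
Lemma edge_then_path_to_cycle (V : finType) (g h : rel V) (x y w : V)
    (K : seq V) :
  symmetric h -> h x y -> x != y ->
  cycle g K -> uniq K -> x \notin K -> w \in K ->
  connect g x w || connect g y w ->
  exists (a b : V) (t : seq V),
    [/\ h b a, path g a t, uniq (b :: a :: t) & (size K <= (size t).+1)%N].
Proof.
move=> hsym hxy nxy cK uK xNK wK conn.
have finish a b q : h b a -> path g a q -> uniq (a :: q) -> last a q \in K ->
    b \notin a :: q -> b \notin K ->
    exists (a b : V) (t : seq V),
    [/\ h b a, path g a t, uniq (b :: a :: t) & (size K <= (size t).+1)%N].
  move=> hba pq uq lK bq bK.
  have [t [pt ut st sub]] := connect_to_long_path pq uq cK uK lK.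
  exists a, b, t; split=> //; rewrite cons_uniq ut andbT.
  by apply/negP => /sub; rewrite mem_cat (negPf bq) (negPf bK).
have [yK|yNK] := boolP (y \in K).
  by apply: (finish y x [::]) => //; rewrite inE.
have main a b : h b a -> h a b -> a != b -> a \notin K -> b \notin K ->
    connect g a w ->
    exists (a b : V) (t : seq V),
    [/\ h b a, path g a t, uniq (b :: a :: t) & (size K <= (size t).+1)%N].
  move=> hba hab nab aNK bNK /connectP[q0 pq0 Ew].
  rewrite {}Ew in wK; case/shortenP: pq0 wK => q pq uq _ lK.
  (* If the path from a passes through b, its part after b avoids a. *)
  have [bq|bNq] := boolP (b \in q); last first.
    by apply: (finish a b q) => //; rewrite inE eq_sym (negPf nab).
  case/splitPr: bq pq uq lK => q1 q2.
  rewrite cat_path last_cat /= mem_cat => /and3P[_ _ p2] /andP[aN] + lK.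
  rewrite cat_uniq => /and3P[_ _ u2].
  by apply: (finish b a q2) => //; move: aN; rewrite negb_or => /andP[].
have hyx : h y x by rewrite hsym.
have nyx : y != x by rewrite eq_sym.
by case/orP: conn; [apply: (main x y) | apply: (main y x)].
Qed.

(** * The bicolored path *)

Theorem lemma2p6 (p : nat) (V : finType) (e : rel V) (c : {set V} -> nat)
  (hp : (1 <= p)%N)
  (he : simple_graph e)
  (hconn : connected_graph e)
  (hc : edge_2coloring e c)
  (hc1 : exists2 f, f \in edges e & c f = 1%N)
  (hc2 : exists2 f, f \in edges e & c f = 2%N)
  (hd : p.+1%:R <= avg_degree (color_subgraph e c 1)) :
  exists (x y : V) (s : seq V),
    [/\ graph_path e x (y :: s),
        (p <= size (y :: s))%N,
        color_subgraph e c 2 x y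
      & path (color_subgraph e c 1) y s].
Proof.
have [esym eirr] := he; have [V_gt0 econn] := hconn.
have csym i : symmetric (color_subgraph e c i).
  by move=> u v; rewrite /color_subgraph /= esym setUC.
set g := color_subgraph e c 1; set h := color_subgraph e c 2.
have girr : irreflexive g by move=> u; rewrite /g /color_subgraph /= eirr.
have color u v : e u v -> g u v || h u v.
  move=> euv; rewrite /g /h /color_subgraph /= euv /=.
  by case: (hc [set u; v]) => [|->|->] //; apply: imset2_f; rewrite ?inE.
have hneq u v : h u v -> u != v.
  by case/andP=> euv _; apply: contraL euv => /eqP ->; rewrite eirr.
have [x [y hxy]] : exists x y, h x y.
  case: hc2 => f /imset2P[x y _]; rewrite inE => /andP[_ exy] -> cf.
  by exists x, y; rewrite /h /color_subgraph /= exy cf.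
have DV : (p.+1 * #|V| <= degree_sum g setT)%N.
  apply: leq_trans (edges_double_le_degree_sum (csym 1%N) girr).
  move: hd; rewrite /avg_degree ler_pdivlMr ?ltr0n //.
  by rewrite -!natrM ler_nat.
have [K [cK uK xNK szK]] :
    exists K, [/\ cycle g K, uniq K, x \notin K & (p <= size K)%N].
  have [K] : exists K : #|V|.-bseq V,
      [&& cycle g K, uniq K, x \notin (K : seq V) & (p <= size K)%N].
    (* Otherwise all cycles avoiding x have at most p - 1 vertices. *)
    apply/existsP/contraT; rewrite negb_exists => /forallP noK.
    have : (degree_sum g [set~ x] <= p.-1 * #|[set~ x]|.-1)%N.
      apply: degree_sum_le_circumference (csym 1%N) girr _ => s cs us sub.
      have ss : (size s <= #|V|)%N by rewrite -(card_uniqP us) max_card.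
      have := noK (Bseq ss); rewrite /= cs us /=.
      have -> : x \notin s by apply/negP => /sub; rewrite !inE eqxx.
      by rewrite /= -ltnNge; case: (p) hp.
    have := degree_sum_setD (csym 1%N) (subsetT [set x]).
    rewrite big_set1 setTD -/g => EV.
    have n1 : (#|nbrs g setT x| <= #|V|)%N by exact: max_card.
    have n2 : (#|nbrs g [set~ x] x| <= #|[set~ x]|)%N.
      by apply: subset_leq_card; apply/subsetP => v; rewrite inE => /andP[].
    move: DV n1 n2; rewrite EV cardsC1.
    by case: (p) hp => // k _ /=; case: (#|V|) V_gt0 => // n _ ? ? ?; nia.
  by case/and4P=> *; exists K.
have [w wK] : exists w, w \in K.
  by case: (K) szK hp => [|w s]; [case: (p) | exists w; rewrite mem_head].
have [x' [y' [hxy' xNK' conn]]] : exists x' y',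
    [/\ h x' y', x' \notin K & connect g x' w || connect g y' w].
  have [cx|ncx] := boolP (connect g x w); first by exists x, y; rewrite cx.
  have gK := connect_cycle cK.
  (* Without an edge of color 2 entering the g-component of K, this component
     would be closed under adjacency and so contain x. *)
  suff /existsP[u /existsP[v /and3P[huv nuw cvw]]] :
      [exists u, exists v, [&& h u v, ~~ connect g u w & connect g v w]].
    exists u, v; rewrite cvw orbT; split=> //.
    by apply: contra nuw => uinK; exact: gK.
  apply: contraNT ncx => /existsPn noedge.
  have clos : closed e [pred u | connect g u w].
    apply: (intro_closed (sym_connect_sym esym)) => u v euv /= cuw.
    have evu : e v u by rewrite esym.
    case/orP: (color v u evu) => [gvu|hvu].
      by apply: connect_trans cuw; exact: connect1.
    have /existsPn/(_ u) := noedge v.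
    by rewrite hvu [connect g u w]cuw andbT negbK.
  by have := closed_connect clos (econn x w); rewrite !inE connect0.
have [a [b [t [hba pt ut st]]]] :=
  edge_then_path_to_cycle (csym 2%N) hxy' (hneq _ _ hxy') cK uK xNK' wK conn.
exists b, a, t; split=> //; last exact: leq_trans szK st.
apply/andP; split=> //; rewrite /= (sub_path _ pt) => [|u v /andP[]//].
by case/andP: hba => ->.
Qed.
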